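(* For every set-indexed family $(f_i:\underline{X}_i\to\underline{Y}_i)_{i\in I}$ of functions between topological spaces, $\operatorname{Lev}^1(\lceil f_i\rceil_{i\in I})=\sup\{\operatorname{Lev}^1(f_i)\mid i\in I\}$.
   Context: For $f:\underline{X}\to\underline{Y}$ define by transfinite recursion $\mathcal{L}^1_0(f)=X$, $\mathcal{L}^1_{\alpha+1}(f)=\{x\in\mathcal{L}^1_\alpha(f)\mid f|_{\mathcal{L}^1_\alpha(f)}\text{ is discontinuous at }x\}$ (subspace topology), and $\mathcal{L}^1_\gamma(f)=\bigcap_{\alpha<\gamma}\mathcal{L}^1_\alpha(f)$ for limit $\gamma$. $\operatorname{Lev}^1(f)=\min\{\alpha\mid\mathcal{L}^1_\alpha(f)=\emptyset\}$; if no such $\alpha$ exists the Level is regarded as a value greater than all ordinals (and a supremum involving it equals it). The coproduct $\coprod_i\underline{X}_i=\bigcup_i\{i\}\times X_i$ carries the smallest topology containing all $\{i\}\times U$, $U$ open in $\underline{X}_i$, and $\lceil f_i\rceil_{i\in I}:\coprod_i\underline{X}_i\to\coprod_i\underline{Y}_i$ is $(i,x)\mapsto(i,f_i(x))$. *)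

(* Defs.v *)
From mathcomp Require Import all_boot all_classical topology.

Set Implicit Arguments.
Unset Strict Implicit.
Unset Printing Implicit Defensive.

Local Open Scope classical_set_scope.

(* Ordinals are ranks of well-founded trees: [Node F] denotes the least        *)
(* ordinal strictly greater than the ordinals denoted by all the [F a].        *)
(* [tree], hence [ord], lives in a universe strictly above the index types,    *)
(* so [ord] cannot be a [choiceType] and [set ord] is not available: orders    *)
(* on it are [Prop]-valued and subsets of it are plain predicates.             *)
Inductive tree : Type := Node (A : Type) (F : A -> tree).

Fixpoint tle (s t : tree) : Prop :=
  let: Node A F := s in
  let: Node B G := t in
  forall a : A, exists b : B, tle (F a) (G b).

Definition tlt (s t : tree) : Prop :=
  let: Node B G := t in exists b : B, tle s (G b).

Definition teq (s t : tree) : Prop := tle s t /\ tle t s.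

Lemma tle_refl s : tle s s.
Proof. by elim: s => A F IH /= a; exists a. Qed.

Lemma tle_trans t s u : tle s t -> tle t u -> tle s u.
Proof.
elim: s t u => A F IH [B G] [C H] /= st tu a.
have [b ab] := st a; have [c bc] := tu b.
by exists c; apply: IH bc.
Qed.

Lemma tle_lt_trans t s u : tle s t -> tlt t u -> tlt s u.
Proof. by case: u => C H /= st [c tc]; exists c; apply: tle_trans tc. Qed.

Lemma tlt_le_trans t s u : tlt s t -> tle t u -> tlt s u.
Proof.
case: t u => B G [C H] /= [b sb] /(_ b)[c bc].
by exists c; apply: tle_trans bc.
Qed.

Lemma tltW s t : tlt s t -> tle s t.
Proof.
elim: s t => A F IH [B G] /= [b sb] a; exists b.
by apply: IH; case: (G b) sb => C H; exact.
Qed.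

Lemma tle_total s t : tle s t \/ tlt t s.
Proof.
elim: s t => A F IH t.
have [|nst] := pselect (tle (Node F) t); first by left.
right; case: t nst => B G /= /existsNP[a Fa]; exists a.
have Glt b : tlt (G b) (F a).
  by have [le_ab|//] := IH a (G b); case: Fa; exists b.
by case: (F a) Glt.
Qed.

Lemma tlt_wf : well_founded tlt.
Proof.
suff H s t : tle t s -> Acc tlt t by move=> s; apply: H (tle_refl s).
elim: s t => A F IH t ts; constructor => u ut.
by have /= [a ua] := tlt_le_trans ut ts; apply: IH ua.
Qed.

Lemma tlt_irr s : ~ tlt s s.
Proof. by elim/(well_founded_ind tlt_wf): s => s IH ss; apply: (IH s). Qed.

(* An ordinal is an equivalence class of trees, so that [=] on [ord] is        *)
(* equality of ordinals.                                                       *)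
Record ord : Type := Ord {
  ord_class : tree -> Prop ;
  ord_classP : exists t, ord_class = teq t }.

Definition ord_of (t : tree) : ord := Ord (ex_intro _ t erefl).

Definition ord_repr (a : ord) : tree := sval (cid (ord_classP a)).

Definition ord_le (a b : ord) : Prop := tle (ord_repr a) (ord_repr b).
Definition ord_lt (a b : ord) : Prop := tlt (ord_repr a) (ord_repr b).

Definition ord_zero : ord := ord_of (Node (fun v : void => match v with end)).
Definition ord_succ (a : ord) : ord := ord_of (Node (fun _ : unit => ord_repr a)).

Lemma ord_reprK a : ord_of (ord_repr a) = a.
Proof.
rewrite /ord_repr; case: (cid _) => /= t; case: a => C p /= eC.
by subst C; congr Ord; exact: Prop_irrelevance.
Qed.

Lemma ord_of_eq s t : teq s t -> ord_of s = ord_of t.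
Proof.
move=> [st ts]; suff e : teq s = teq t.
  rewrite /ord_of; move: (ex_intro _ s _) (ex_intro _ t _).
  by rewrite e => p q; congr Ord; exact: Prop_irrelevance.
apply: funext => u; apply: propext.
by split=> -[? ?]; split; apply: tle_trans; eassumption.
Qed.

Lemma ord_repr_of t : teq (ord_repr (ord_of t)) t.
Proof.
rewrite /ord_repr; case: (cid _) => /= s ets.
have : teq t t by split; exact: tle_refl.
by rewrite {1}ets.
Qed.

Lemma ord_le_refl a : ord_le a a. Proof. exact: tle_refl. Qed.

Lemma ord_le_trans b a c : ord_le a b -> ord_le b c -> ord_le a c.
Proof. exact: tle_trans. Qed.

Lemma ord_le_anti a b : ord_le a b -> ord_le b a -> a = b.
Proof. by move=> ab ba; rewrite -(ord_reprK a) -(ord_reprK b); apply: ord_of_eq. Qed.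

Lemma ord_ltW a b : ord_lt a b -> ord_le a b. Proof. exact: tltW. Qed.

Lemma ord_le_lt_trans b a c : ord_le a b -> ord_lt b c -> ord_lt a c.
Proof. exact: tle_lt_trans. Qed.

Lemma ord_lt_le_trans b a c : ord_lt a b -> ord_le b c -> ord_lt a c.
Proof. exact: tlt_le_trans. Qed.

Lemma ord_lt_irr a : ~ ord_lt a a. Proof. exact: tlt_irr. Qed.

Lemma ord_leVlt a b : ord_le a b \/ ord_lt b a. Proof. exact: tle_total. Qed.

Lemma ord_lt_wf : well_founded ord_lt.
Proof.
move=> a; move: {2}(ord_repr a) (erefl (ord_repr a)) => t.
elim/(well_founded_ind tlt_wf): t a => t IH a ea; constructor => b ba.
by apply: (IH (ord_repr b)); rewrite // -ea.
Qed.

Lemma ord_zero_le a : ord_le ord_zero a.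
Proof.
have [h _] := ord_repr_of (Node (fun v : void => match v with end)).
by apply: tle_trans h _; case: (ord_repr a) => A F [].
Qed.

Lemma ord_ltS a b : ord_lt b (ord_succ a) <-> ord_le b a.
Proof.
have [h1 h2] := ord_repr_of (Node (fun _ : unit => ord_repr a)).
split=> [/tlt_le_trans/(_ h1)[]//|ba].
by apply: tlt_le_trans h2; exists tt.
Qed.

Lemma ord_succ_inj : injective ord_succ.
Proof.
move=> a b e; apply: ord_le_anti; apply/ord_ltS.
  by rewrite -e; apply/ord_ltS/ord_le_refl.
by rewrite e; apply/ord_ltS/ord_le_refl.
Qed.

Lemma ord_least (P : ord -> Prop) : (exists a, P a) ->
  exists a, P a /\ forall b, P b -> ord_le a b.
Proof.
move=> [a]; elim/(well_founded_ind ord_lt_wf): a => a IH Pa.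
have [[b [ba Pb]]|h] := pselect (exists b, ord_lt b a /\ P b).
  exact: IH ba Pb.
exists a; split=> // b Pb; have [//|ba] := ord_leVlt a b.
by case: h; exists b.
Qed.

Lemma ord_bounded (A : Type) (F : A -> ord) :
  exists b, forall a, ord_lt (F a) b.
Proof.
exists (ord_of (Node (ord_repr \o F))) => a.
have [_ h] := ord_repr_of (Node (ord_repr \o F)).
by apply: tlt_le_trans h; exists a; exact: tle_refl.
Qed.

(* Ordinals together with a value greater than all of them.                    *)
Inductive level : Type := Fin of ord | Infty.

Definition level_le (x y : level) : Prop :=
  match x, y with
  | Fin a, Fin b => ord_le a b
  | _, Infty => True
  | Infty, Fin _ => False
  end.

Definition level_is_sup (S : level -> Prop) (l : level) : Prop :=
  (forall x, S x -> level_le x l) /\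
  (forall u, (forall x, S x -> level_le x u) -> level_le l u).

Lemma level_le_anti x y : level_le x y -> level_le y x -> x = y.
Proof. by case: x y => [a|] [b|] //= ab ba; rewrite (ord_le_anti ab ba). Qed.

Lemma level_sup_exists (S : level -> Prop) : exists l, level_is_sup S l.
Proof.
have [/ord_least[a [ua la]]|h] :=
  pselect (exists a, forall x, S x -> level_le x (Fin a)).
  by exists (Fin a); split=> // -[b|//] ub; exact: la.
by exists Infty; split=> [[]//|[b|//] ub]; case: h; exists b.
Qed.

Definition level_sup (S : level -> Prop) : level := sval (cid (level_sup_exists S)).

Lemma level_supP (S : level -> Prop) : level_is_sup S (level_sup S).
Proof. by rewrite /level_sup; case: cid. Qed.

(* This also forces the universe of [ord] to be large enough for [level_sup]   *)
(* not to reach [Infty] on small families of ordinals.                         *)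
Lemma level_sup_Fin (I : choiceType) (F : I -> ord) :
  exists a, level_sup (fun l => exists i, l = Fin (F i)) = Fin a.
Proof.
have [b Fb] := ord_bounded F.
have [_ /(_ (Fin b))] := level_supP (fun l => exists i, l = Fin (F i)).
case: (level_sup _) => [a _|]; first by exists a.
by case=> _ [i ->]; exact: ord_ltW.
Qed.

Section Level1.
Context {X Y : topologicalType} (f : X -> Y).

Definition discont_in (A : set X) : set X :=
  [set x | A x /\ ~ {for (x : subspace A), continuous (from_subspace A f)}].

(* When [a] is not a successor it is either a limit or 0; in the latter case   *)
(* the intersection is over no index at all, hence the whole space.            *)
Definition L1_step (a : ord) (L : forall b, ord_lt b a -> set X) : set X :=
  match pselect (exists b, a = ord_succ b) with
  | left h =>
      let: exist b e := cid h in
      discont_in (L b (eq_ind_r (ord_lt b) (proj2 (ord_ltS b b) (ord_le_refl b)) e))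
  | right _ => [set x | forall b (ba : ord_lt b a), L b ba x]
  end.

Definition L1 : ord -> set X := Fix ord_lt_wf (fun=> set X) L1_step.

Definition Lev1 : level :=
  match pselect (exists a, L1 a = set0) with
  | left h => Fin (sval (cid (ord_least h)))
  | right _ => Infty
  end.

Lemma L1E a : L1 a = @L1_step a (fun b _ => L1 b).
Proof.
rewrite /L1 Fix_eq// => {}a L L' LL'; rewrite /L1_step.
case: pselect => [h|_]; first by case: cid => b e; rewrite LL'.
by apply/seteqP; split=> x h b ba; move: (h b ba); rewrite LL'.
Qed.

Lemma L1_0 : L1 ord_zero = setT.
Proof.
have lt0 b : ~ ord_lt b ord_zero.
  by move=> /ord_lt_le_trans/(_ (ord_zero_le b))/ord_lt_irr.
rewrite L1E /L1_step; case: pselect => [[b e]|_].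
  by case: (lt0 b); rewrite e; apply/ord_ltS/ord_le_refl.
by apply/seteqP; split=> // x _ b /lt0.
Qed.

Lemma L1_S a : L1 (ord_succ a) = discont_in (L1 a).
Proof.
rewrite L1E /L1_step; case: pselect => [h|]; last by case; exists a.
by case: cid => b /ord_succ_inj ->.
Qed.

Lemma L1_lim a : a <> ord_zero -> (forall b, a <> ord_succ b) ->
  L1 a = [set x | forall b, ord_lt b a -> L1 b x].
Proof.
move=> _ aS; rewrite L1E /L1_step; case: pselect => // h.
by exfalso; case: h => b /aS.
Qed.

Lemma L1_le a b : ord_le a b -> L1 b `<=` L1 a.
Proof.
elim/(well_founded_ind ord_lt_wf): b a => b IH a ab.
have [ba|ltab] := ord_leVlt b a; first by rewrite (ord_le_anti ab ba).
have [[c bE]|bS] := pselect (exists c, b = ord_succ c); last first.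
  by rewrite (L1E b) /L1_step; case: pselect => // _ x; exact.
move: ltab; rewrite bE L1_S => /ord_ltS ac x [+ _].
by apply: IH ac x; rewrite bE; apply/ord_ltS/ord_le_refl.
Qed.

Lemma Lev1_Fin a :
  Lev1 = Fin a <-> L1 a = set0 /\ forall b, L1 b = set0 -> ord_le a b.
Proof.
rewrite /Lev1; split=> [|[a0 la]].
  by case: pselect => // h [<-]; case: cid.
case: pselect => [h|[]]; last by exists a.
by case: cid => /= b [b0 lb]; congr Fin; apply: ord_le_anti; [exact: lb|exact: la].
Qed.

(* The sequence [L1] is stationary. This also forces the universe of [ord] to  *)
(* be large enough for [Lev1] not to be [Infty] merely for lack of ordinals.   *)
Lemma L1_stationary : exists a, L1 (ord_succ a) = L1 a.
Proof.
have /choice[r rP] x : exists a, forall b, L1 a x -> L1 b x.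
  have [h|/existsNP[a nax]] := pselect (forall a, L1 a x).
    by exists ord_zero.
  by exists a.
have [s rs] := ord_bounded r; exists s; apply/seteqP; split.
  by apply: L1_le; apply/ord_ltW/ord_ltS/ord_le_refl.
by move=> x sx; apply: rP; apply: L1_le sx; exact: ord_ltW.
Qed.

End Level1.

(* [{i & X i}] carries the library's disjoint union topology, which is the     *)
(* smallest one containing the sets [existT X i @` U] with [U] open.           *)
Lemma sigT_open_smallest (I : choiceType) (X : I -> topologicalType)
    (O : set {i & X i} -> Prop) :
  (forall F : set {i & X i} -> Prop, (forall U, F U -> O U) ->
    O [set x | exists2 U, F U & U x]) ->
  (forall i (U : set (X i)), open U -> O (existT X i @` U)) ->
  forall W, open W -> O W.
Proof.
move=> OU OX W /sigT_openP oW.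
have -> : W = [set x | exists2 U,
    exists i, U = existT X i @` (existT X i @^-1` W) & U x].
  apply/seteqP; split=> [[i x] Wx|[i x] [_ [j ->]] [y Wy <-]//].
  by exists (existT X i @` (existT X i @^-1` W)); [exists i|exists x].
by apply: OU => _ [i ->]; exact: OX.
Qed.

Definition coprod_map (I : choiceType) (X Y : I -> topologicalType)
    (f : forall i, X i -> Y i) (x : {i & X i}) : {i & Y i} :=
  existT Y (projT1 x) (f (projT1 x) (projT2 x)).

(* Main.v *)
Require Import Defs.
From mathcomp Require Import all_boot all_classical topology.

(* On a coproduct, neighbourhoods and hence discontinuity points are computed  *)
(* componentwise, so by transfinite induction the set L1 a of the coproduct    *)
(* map meets the i-th summand exactly in the set L1 a of f i. Thus L1 a of the *)
(* coproduct map is empty iff all the sets L1 a of the f i are, i.e. both      *)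
(* sides of the theorem have the same upper bounds.                            *)

Local Open Scope classical_set_scope.

(** At points of [A], subspace neighbourhoods are traces of ambient ones. *)
Lemma discont_inE (X Y : topologicalType) (f : X -> Y) (A : set X) x :
  discont_in f A x <->
  A x /\ ~ (forall V, nbhs (f x) V -> nbhs x [set y | A y -> V (f y)]).
Proof.
rewrite /discont_in /=; split=> -[Ax nc]; split=> // c; apply: nc;
  by move=> V /c; rewrite /= /nbhs /= -nbhs_subspace_in.
Qed.

Lemma discont_in_coprod_map (I : choiceType) (X Y : I -> topologicalType)
    (f : forall i, X i -> Y i) (A : set {i & X i}) i (x : X i) :
  discont_in (coprod_map f) A (existT X i x) <->
  discont_in (f i) (existT X i @^-1` A) x.
Proof.
rewrite !discont_inE; split=> -[Ax nc]; split=> // c; apply: nc.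
  by move=> V; exact: c.
(* Summands are open, so the image of [V] is a neighbourhood in the coproduct. *)
move=> V /existT_nbhs/c; apply: (@filterS _ (nbhs x)) => y /= h /h[z Vz].
by move=> /(@existT_inj2 _ _ _ _ (f i y)) <-.
Qed.

Lemma L1_coprod_map (I : choiceType) (X Y : I -> topologicalType)
    (f : forall i, X i -> Y i) a i :
  existT X i @^-1` L1 (coprod_map f) a = L1 (f i) a.
Proof.
elim/(well_founded_ind ord_lt_wf): a i => a IH i.
have [[b ab]|aS] := pselect (exists b, a = ord_succ b).
  rewrite ab !L1_S -IH ?ab; last exact/ord_ltS/ord_le_refl.
  by apply/seteqP; split=> x /discont_in_coprod_map.
(* Zero and limit stages alike are intersections of earlier stages. *)
rewrite !L1E /L1_step; case: pselect => // _.
by apply/seteqP; split=> x h b ba; move: (h b ba); rewrite -IH.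
Qed.

(** The sets [L1 f a] decrease, so once empty they stay empty. *)
Lemma Lev1_leP (X Y : topologicalType) (f : X -> Y) a :
  level_le (Lev1 f) (Fin a) <-> L1 f a = set0.
Proof.
case E: (Lev1 f) => [b|] /=.
  have [b0 lb] := (Lev1_Fin f b).1 E; split=> [ba|]; last exact: lb.
  by rewrite -subset0 -b0; exact: L1_le.
split=> // a0; move: E; rewrite /Lev1; case: pselect => // -[].
by exists a.
Qed.

Lemma Lev1_coprod_map_le (I : choiceType) (X Y : I -> topologicalType)
    (f : forall i, X i -> Y i) u :
  level_le (Lev1 (coprod_map f)) u <-> forall i, level_le (Lev1 (f i)) u.
Proof.
case: u => [a|]; last by split=> *; case: (Lev1 _).
rewrite Lev1_leP; split=> [f0 i|f0].
  by rewrite Lev1_leP -L1_coprod_map f0.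
rewrite -subset0 => -[i x] fx; have /Lev1_leP := f0 i.
by rewrite -L1_coprod_map => /seteqP[/(_ x fx)].
Qed.

Theorem theorem5p13 (I : choiceType) (X Y : I -> topologicalType)
    (f : forall i, X i -> Y i) :
  Lev1 (coprod_map f) = level_sup (fun l => exists i, l = Lev1 (f i)).
Proof.
have [ub lub] := level_supP (fun l => exists i, l = Lev1 (f i)).
apply: level_le_anti.
  by apply/Lev1_coprod_map_le => i; apply: ub; exists i.
(* [Lev1 (coprod_map f)] bounds itself, hence every [Lev1 (f i)]. *)
apply: lub => _ [i ->]; move: i; apply/Lev1_coprod_map_le.
by case: (Lev1 _) => //= a; exact: ord_le_refl.
Qed.
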